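(* Let $W$ be the Weyl group of a split connected reductive algebraic group over a finite field (with respect to a split maximal torus $T$), with length function $\ell$ and Bruhat order $\leq$ determined by the choice of a Borel subgroup $B\supset T$. Let $R_{v,w}$ and $P_{v,w}$ ($v\leq w$ in $W$) be the $R$-polynomials and the Kazhdan-Lusztig polynomials of $W$. Then for all $v,w\in W$ such that $v<w$, the polynomial $P_{v,w}$ is equal to $$\tau_{\leq \ell(w)-\ell(v)-1}\Bigl(\sum_{v=v_1<\dots<v_r<w}(-1)^r R_{v_1,v_2}\,\tau_{\leq \ell(w)-\ell(v_2)}\bigl(R_{v_2,v_3}\cdots \tau_{\leq \ell(w)-\ell(v_{r-1})}\bigl(R_{v_{r-1},v_r}\,\tau_{\leq \ell(w)-\ell(v_r)}(R_{v_r,w})\bigr)\cdots\bigr)\Bigr),$$ where the sum runs over all $r\geq 1$ and all chains $v=v_1<v_2<\dots<v_r<w$ in $W$ for the Bruhat order (for $r=1$ the summand is $-R_{v,w}$).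
   Context: Setting: $G$ is a split connected reductive algebraic group over a finite field $\mathbb{F}_q$, $B$ a Borel subgroup defined over $\mathbb{F}_q$, $T\subset B$ a maximal torus split over $\mathbb{F}_q$, $N$ the normalizer of $T$ in $G$, $W=N/T$ the Weyl group, $\Delta$ the set of simple roots determined by $B$, $\ell$ the length function on $W$ associated to $\Delta$, $\leq$ the Bruhat order on $W$. Hecke algebra: $\mathcal{H}$ is the algebra over $\mathbb{Z}[t^{1/2},t^{-1/2}]$ generated by elements $T_w$, $w\in W$, with relations $T_wT_{w'}=T_{ww'}$ if $\ell(ww')=\ell(w)+\ell(w')$, and $(T_s+1)(T_s-t)=0$ if $s$ is the reflection associated to a simple root. $R$-polynomials: the polynomials $R_{v,w}\in\mathbb{Z}[t]$, for $v\leq w$ in $W$, are defined by $$T_{w^{-1}}^{-1}=\sum_{v\leq w}(-1)^{\ell(w)-\ell(v)}R_{v,w}(t)\,t^{-\ell(w)}\,T_v .$$ Kazhdan-Lusztig polynomials: $(P_{v,w})_{v\leq w}$ is the unique family of polynomials in $\mathbb{Z}[t]$ with $P_{w,w}=1$, $P_{v,w}$ of degree $\leq \frac12(\ell(w)-\ell(v)-1)$ if $v<w$, and such that for all $v\leq w$ in $W$, $$t^{\ell(w)-\ell(v)}P_{v,w}(t^{-1})=\sum_{v\leq y\leq w}R_{v,y}(t)P_{y,w}(t).$$ Truncation: for $d\in\mathbb{Q}$, $\tau_{\leq d}$ is the $\mathbb{Q}$-linear endomorphism of $\mathbb{Q}[t^{1/2},t^{-1/2}]$ defined by $\tau_{\leq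 d}\bigl(\sum_{i\in\mathbb{Z}}a_i t^{i/2}\bigr)=\sum_{i\leq d}a_i t^{i/2}$ (so the bound $d$ applies to the exponent counted in powers of $t^{1/2}$). *)

(* Defs.v *)
From HB Require Import structures.
From mathcomp Require Import all_boot all_order all_fingroup all_algebra.
From mathcomp Require Import finmap.
From mathcomp Require monalg.
From mathcomp Require Import mpoly.
From mathcomp Require Import boolp.

Set Implicit Arguments.
Unset Strict Implicit.
Unset Printing Implicit Defensive.

Import Order.TTheory GRing.Theory Num.Theory.
Local Open Scope ring_scope.

(******************************************************************************)
(* Laurent polynomials R[u, u^-1]. Throughout, u stands for t^(1/2): the      *)
(* coefficient of index i : int is the coefficient of t^(i/2).                *)
(* The library only puts a ring structure on {malg R[K]} when the monomials   *)
(* K have no nontrivial units, which excludes K = int; the convolution        *)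
(* product is therefore redone here for K = int.                              *)
(******************************************************************************)
Module Laurent.
Import monalg.

Section Def.
Variable R : comNzRingType.

Definition laurent := {malg R[int]}.
#[export] HB.instance Definition _ := GRing.Zmodule.on laurent.

Implicit Types g : laurent.
Local Open Scope fset_scope.
Local Open Scope ring_scope.

Definition monomial (c : R) (i : int) : laurent := << c *g i >>.

Definition coef g (i : int) : R := mcoeff i g.

Definition one : laurent := monomial 1 0.

Definition mul g1 g2 : laurent :=
  \sum_(i <- monalg.msupp g1) \sum_(j <- monalg.msupp g2) monomial (coef g1 i * coef g2 j) (i + j).

Lemma monomial0 i : monomial 0 i = 0.
Proof. exact: monalgU0. Qed.

Lemma monomialD c1 c2 i : monomial (c1 + c2) i = monomial c1 i + monomial c2 i.
Proof. exact: monalgUD. Qed.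

Lemma mulEw (d1 d2 : {fset int}) g1 g2 :
  monalg.msupp g1 `<=` d1 -> monalg.msupp g2 `<=` d2 ->
  mul g1 g2 = \sum_(i <- d1) \sum_(j <- d2) monomial (coef g1 i * coef g2 j) (i + j).
Proof.
move=> le1 le2; rewrite /mul (big_fset_incl _ le1) /=; last first.
  move=> i _ /monalg.mcoeff_outdom g1i; rewrite big1 // => j _.
  by rewrite /coef g1i mul0r monomial0.
apply/eq_bigr=> i _; apply/big_fset_incl => // j _ /monalg.mcoeff_outdom gj.
by rewrite /coef gj mulr0 monomial0.
Qed.

Lemma mulC : commutative mul.
Proof.
move=> g1 g2; rewrite /mul exchange_big; apply/eq_bigr => j _.
by apply/eq_bigr => i _; rewrite mulrC addrC.
Qed.

Lemma mulMM c1 c2 i j :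
  mul (monomial c1 i) (monomial c2 j) = monomial (c1 * c2) (i + j).
Proof.
by rewrite (mulEw monalg.msuppU_le monalg.msuppU_le) !big_seq_fset1 /monomial /coef !monalg.mcoeffUU.
Qed.

Lemma mulDl : left_distributive mul +%R.
Proof.
move=> g1 g2 g.
rewrite (mulEw (monalg.msuppD_le g1 g2) (fsubset_refl (monalg.msupp g))).
rewrite (mulEw (fsubsetUl (monalg.msupp g1) (monalg.msupp g2)) (fsubset_refl (monalg.msupp g))).
rewrite (mulEw (fsubsetUr (monalg.msupp g1) (monalg.msupp g2)) (fsubset_refl (monalg.msupp g))).
rewrite -big_split /=; apply/eq_bigr=> i _.
rewrite -big_split /=; apply/eq_bigr=> j _.
by rewrite /coef monalg.mcoeffD mulrDl monomialD.
Qed.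

Lemma mulDr : right_distributive mul +%R.
Proof. by move=> g g1 g2; rewrite mulC mulDl !(mulC g). Qed.

Lemma mul0g g : mul 0 g = 0.
Proof. by rewrite /mul monalg.msupp0 big_seq_fset0. Qed.

Lemma mulg0 g : mul g 0 = 0.
Proof. by rewrite mulC mul0g. Qed.

Lemma mul_suml (I : Type) (r : seq I) (F : I -> laurent) g :
  mul (\sum_(i <- r) F i) g = \sum_(i <- r) mul (F i) g.
Proof.
exact: (big_morph (mul^~ g) (fun x y => mulDl x y g) (mul0g g)).
Qed.

Lemma mul_sumr (I : Type) (r : seq I) (F : I -> laurent) g :
  mul g (\sum_(i <- r) F i) = \sum_(i <- r) mul g (F i).
Proof. exact: (big_morph (mul g) (mulDr g) (mulg0 g)). Qed.

Lemma laurentE g : g = \sum_(i <- monalg.msupp g) monomial (coef g i) i.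
Proof. exact: monalgE. Qed.

Lemma mul1g : left_id one mul.
Proof.
move=> g; rewrite [in LHS](laurentE g) mul_sumr [RHS]laurentE.
by apply/eq_bigr => i _; rewrite mulMM mul1r add0r.
Qed.

Lemma mulA : associative mul.
Proof.
move=> g1 g2 g3; rewrite (laurentE g1) !mul_suml; apply/eq_bigr => i _.
rewrite (laurentE g2) mul_suml !mul_sumr mul_suml; apply/eq_bigr => j _.
rewrite (laurentE g3) !mul_sumr; apply/eq_bigr => k _.
by rewrite !mulMM mulrA addrA.
Qed.

Lemma one_neq0 : one != 0.
Proof.
by apply/eqP => /malgP /(_ 0) /eqP; rewrite !monalg.mcoeffsE oner_eq0.
Qed.

#[export] HB.instance Definition _ :=
  GRing.Zmodule_isComNzRing.Build laurent mulA mulC mul1g mulDl one_neq0.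

Definition supp g : seq int := monalg.msupp g.

End Def.

Module Exports. HB.reexport. End Exports.
End Laurent.
Export Laurent.Exports.

Notation laurent := Laurent.laurent.
Notation monomial := Laurent.monomial.

(* t^z = u^(2 z) *)
Definition tpow (R : comNzRingType) (z : int) : laurent R := monomial 1 (2 * z).

(* p(x), for p with integer coefficients and x in any commutative ring *)
Definition eval_at (A : comNzRingType) (p : {poly int}) (x : A) : A :=
  (map_poly intr p).[x].

(* tau_{<= d} : the bound applies to exponents counted in powers of t^(1/2) *)
Definition tau (d : rat) (g : laurent rat) : laurent rat :=
  \sum_(i <- Laurent.supp g | i%:~R <= d) monomial (Laurent.coef g i) i.

(******************************************************************************)
(* Linear algebraic groups over a subfield F of an algebraically closed       *)
(* field k, in the language of Zariski-closed subgroups of GL_n(k).           *)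
(******************************************************************************)
Section AlgebraicGroups.
Variables (k : closedFieldType) (n : nat).
Implicit Types (G H T B N X : 'M[k]_n -> Prop) (x y t : 'M[k]_n).

Definition entries x : 'I_(n * n) -> k := fun i => mxvec x 0 i.

(* X is the zero locus in GL_n(k) of polynomials in the matrix entries with
   coefficients in F. As 1/det is invertible on GL_n, polynomials in the entries
   suffice. When F is perfect and k is an algebraic closure of F, a closed
   subset is of this form iff it is defined over F. *)
Definition zclosed_over (F : fieldType) (iota : {rmorphism F -> k}) X : Prop :=
  exists E : {mpoly F[n * n]} -> Prop, forall x, X x <->
    x \in unitmx /\ forall f, E f -> (map_mpoly iota f).@[entries x] = 0.

Definition zclosed X : Prop := zclosed_over idfun X.

Definition incl X Y : Prop := forall x : 'M[k]_n, X x -> Y x.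

Definition zconnected X : Prop :=
  forall A B, zclosed A -> zclosed B -> (forall x, X x -> A x \/ B x) ->
    (forall x, X x -> ~ (A x /\ B x)) -> incl X A \/ incl X B.

Definition is_subgroup H : Prop :=
  [/\ incl H (fun x => x \in unitmx), H 1%:M,
      forall x y, H x -> H y -> H (x *m y) & forall x, H x -> H (invmx x)].

Definition alg_subgroup G H : Prop :=
  [/\ is_subgroup H, zclosed H & incl H G].

Definition connected_subgroup G H : Prop := alg_subgroup G H /\ zconnected H.

Definition normal_subgroup G H : Prop :=
  forall x y, G x -> H y -> H (x *m y *m invmx x).

Definition unipotent H : Prop :=
  forall x, H x -> exists m, (x - 1%:M) ^+ m = 0.

Definition derived_subgroup H : 'M[k]_n -> Prop := fun z =>
  forall K, is_subgroup K ->
    (forall x y, H x -> H y -> K (x *m y *m invmx x *m invmx y)) -> K z.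

Definition solvable_group H : Prop :=
  exists m, forall x, iter m derived_subgroup H x -> x = 1%:M.

(* connected, with trivial unipotent radical *)
Definition connected_reductive G : Prop :=
  connected_subgroup G G /\
  forall U, connected_subgroup G U -> normal_subgroup G U -> unipotent U ->
    forall x, U x -> x = 1%:M.

Definition diagonalizable_over (F : fieldType) (iota : {rmorphism F -> k}) H :=
  exists2 g : 'M[F]_n, g \in unitmx & forall x, H x ->
    is_diag_mx (map_mx iota g *m x *m invmx (map_mx iota g)).

Definition torus_of G T : Prop :=
  connected_subgroup G T /\ diagonalizable_over idfun T.

Definition maximal_torus G T : Prop :=
  torus_of G T /\ forall T', torus_of G T' -> incl T T' -> incl T' T.

Definition borel_subgroup G B : Prop :=
  (connected_subgroup G B /\ solvable_group B) /\
  forall B', connected_subgroup G B' -> solvable_group B' ->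
    incl B B' -> incl B' B.

Definition normalizer G T : 'M[k]_n -> Prop := fun x =>
  G x /\ forall t, T t <-> T (x *m t *m invmx x).

Definition identity_component H : 'M[k]_n -> Prop := fun x =>
  exists2 C, connected_subgroup H C & C x.

(* The tangent space of G at 1, as a subspace of M_n(k); the adjoint action is
   then conjugation. *)
Definition lie G (X : 'M[k]_n) : Prop :=
  forall f : {mpoly k[n * n]}, (forall x, G x -> f.@[entries x] = 0) ->
    \sum_i (f^`M(i)).@[entries 1%:M] * entries X i = 0.

(* alpha is a nontrivial weight of T on Lie(H). Only the restriction of alpha
   to T is meaningful; it is automatically a regular character of T. *)
Definition is_root T H (alpha : 'M[k]_n -> k) : Prop :=
  (exists2 t, T t & alpha t <> 1) /\
  exists X : 'M[k]_n, [/\ X <> 0, lie H X &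
    forall t, T t -> t *m X *m invmx t = alpha t *: X].

(* The positive roots attached to B are the roots of T in Lie(B); the simple
   ones are those that are not a sum of two positive roots. Characters are
   written multiplicatively. *)
Definition simple_root T B (alpha : 'M[k]_n -> k) : Prop :=
  is_root T B alpha /\
  ~ exists beta gamma, [/\ is_root T B beta, is_root T B gamma &
      forall t, T t -> alpha t = beta t * gamma t].

(* pi restricts to a surjective morphism N -> W with kernel T *)
Definition is_quotient N T (W : finGroupType) (pi : 'M[k]_n -> W) : Prop :=
  [/\ forall x y, N x -> N y -> pi (x *m y) = (pi x * pi y)%g,
      forall w, exists2 x, N x & pi x = w
    & forall x, N x -> (pi x = 1%g <-> T x)].

(* s_alpha is the nontrivial element of the Weyl group of the centralizer of
   the torus (Ker alpha)^0, a group of order 2. *)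
Definition is_reflection G T (W : finGroupType) (pi : 'M[k]_n -> W)
    (alpha : 'M[k]_n -> k) (w : W) : Prop :=
  w <> 1%g /\
  exists x, [/\ normalizer G T x, pi x = w &
    forall z, identity_component (fun t => T t /\ alpha t = 1) z ->
      x *m z = z *m x].

Definition simple_reflections G T B (W : finGroupType) (pi : 'M[k]_n -> W) :
    {set W} :=
  [set w | `[< exists2 alpha, simple_root T B alpha &
                 is_reflection G T pi alpha w >] ].

End AlgebraicGroups.

(* G is a connected reductive group over the finite field F, B a Borel subgroup
   defined over F and T a maximal torus of G contained in B and split over F;
   k is an algebraic closure of F. *)
Record split_reductive (F : finFieldType) (k : closedFieldType)
    (iota : {rmorphism F -> k}) (n : nat) (G B T : 'M[k]_n -> Prop) : Prop := {
  alg_closure : forall x, algebraicOver iota x;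
  G_defined : zclosed_over iota G;
  G_reductive : connected_reductive G;
  B_defined : zclosed_over iota B;
  B_borel : borel_subgroup G B;
  T_defined : zclosed_over iota T;
  T_maximal : maximal_torus G T;
  T_split : diagonalizable_over iota T;
  T_sub_B : incl T B }.

Section WeylGroup.
Variables (W : finGroupType) (S : {set W}).
Implicit Types v w y : W.

(* Least m such that w is a product of m elements of S. Reduced words have
   pairwise distinct prefixes, so the search below #|W| finds it whenever S
   generates W. *)
Definition len w : nat := find (fun m => w \in (S ^+ m)%g) (iota 0 #|W|).

(* The reflections of W are the conjugates of the simple reflections. *)
Definition bruhat_step v w : bool :=
  [exists r in class_support S [set: W], w == (v * r)%g] && (len v < len w)%N.

Definition bruhat : rel W := connect bruhat_step.

Definition bruhat_lt v w : bool := (v != w) && bruhat v w.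

Definition hecke_relations (A : algType (laurent int)) (T : W -> A) : Prop :=
  (forall v w, len (v * w)%g = (len v + len w)%N -> T v * T w = T (v * w)%g) /\
  (forall s, s \in S -> (T s + 1) * (T s - (tpow int 1)%:A) = 0).

(* H is presented by the generators T_w and the Hecke relations. *)
Definition is_hecke_algebra (H : algType (laurent int)) (T : W -> H) : Prop :=
  hecke_relations T /\
  forall (A : algType (laurent int)) (T' : W -> A), hecke_relations T' ->
    (exists f : {lrmorphism H -> A}, forall w, f (T w) = T' w) /\
    (forall f g : {lrmorphism H -> A},
       (forall w, f (T w) = g (T w)) -> f =1 g).

Definition is_inverse (H : algType (laurent int)) (a b : H) : Prop :=
  a * b = 1 /\ b * a = 1.

(* T_{w^-1}^-1 = sum_{v <= w} (-1)^(l(w)-l(v)) R_{v,w}(t) t^(-l(w)) T_v *)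
Definition is_R_family (H : algType (laurent int)) (T : W -> H)
    (R : W -> W -> {poly int}) : Prop :=
  forall w, is_inverse (T w^-1%g)
    (\sum_(v | bruhat v w)
       ((-1) ^+ (len w - len v) * eval_at (R v w) (tpow int 1)
          * tpow int (- (len w)%:Z)) *: T v).

Definition is_KL_family (R P : W -> W -> {poly int}) : Prop :=
  [/\ forall w, P w w = 1,
      forall v w, bruhat_lt v w ->
        (2 * (size (P v w)).-1 <= len w - len v - 1)%N
    & forall v w, bruhat v w ->
        tpow int ((len w)%:Z - (len v)%:Z) * eval_at (P v w) (tpow int (- 1))
        = \sum_(y | bruhat v y && bruhat y w)
            eval_at (R v y) (tpow int 1) * eval_at (P y w) (tpow int 1)].

(* c = [:: v_1; ...; v_r] with v = v_1 < ... < v_r < w *)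
Definition is_chain v w (c : seq W) : bool :=
  if c is v1 :: c' then (v1 == v) && path bruhat_lt v1 (rcons c' w) else false.

(* For c = [:: v_1; ...; v_r]:
   R_{v_1,v_2} tau_{<= l(w)-l(v_2)} (R_{v_2,v_3} ... tau_{<= l(w)-l(v_r)} (R_{v_r,w})).
   The value on the empty sequence is irrelevant. *)
Fixpoint chain_term (R : W -> W -> {poly int}) w (c : seq W) : laurent rat :=
  match c with
  | [::] => 0
  | [:: v] => eval_at (R v w) (tpow rat 1)
  | v :: (v' :: _) as c' =>
      eval_at (R v v') (tpow rat 1)
        * tau ((len w)%:R - (len v')%:R) (chain_term R w c')
  end.

(* The elements of a chain are distinct, hence r <= #|W|. *)
Definition chain_sum (R : W -> W -> {poly int}) v w : laurent rat :=
  \sum_(1 <= r < #|W|.+1) \sum_(c : r.-tuple W | is_chain v w c)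
    (-1) ^+ r * chain_term R w c.

End WeylGroup.

(* Main.v *)
Require Import Defs.
From HB Require Import structures.
From mathcomp Require Import all_boot all_order all_fingroup all_algebra.
From mathcomp Require monalg.
From mathcomp Require Import zify.

(** Let m = l(w) - l(v) > 0. Taking v = w in the identity that defines the
    Kazhdan-Lusztig family gives R_{w,w} = 1 ([R_diag]), so for v < w the identity
    reads
      t^m P_{v,w}(t^-1) - P_{v,w}(t)
        = R_{v,w}(t) + sum_{v < y < w} R_{v,y}(t) P_{y,w}(t).
    Counted in powers of t^(1/2), the degree bound puts the exponents of P_{v,w}
    at most m - 1 and those of t^m P_{v,w}(t^-1) at least m + 1. Truncation
    therefore isolates P_{v,w}: for d = m as well as for d = m - 1,
      P_{v,w} = tau_{<= d} (- R_{v,w} - sum_{v < y < w} R_{v,y} P_{y,w})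
    ([KL_tau]). The sum over chains satisfies the same recursion, obtained by
    separating the first step v < y of a chain ([chain_sum_sizeS]); here tau is
    linear and the truncation at l(w) - l(y) is applied just before the product
    with R_{v,y}.
    The formula follows by induction on the length of chains
    ([tau_partial_chain_sum]), chains from v to w having at most
    l(w) - l(v) <= #|W| elements besides w. *)

Set Implicit Arguments.
Unset Strict Implicit.

Import GRing.Theory.
Local Open Scope ring_scope.

(** * Coefficients of Laurent polynomials *)

Section LaurentPolynomials.
Import Num.Theory.
Variable A : comNzRingType.
Implicit Types (f g : laurent A) (p q : {poly int}).

Lemma laurentP f g : (forall i, Laurent.coef f i = Laurent.coef g i) -> f = g.
Proof. by move=> e; apply/monalg.malgP. Qed.

Lemma laurent_coefD f g i :
  Laurent.coef (f + g) i = Laurent.coef f i + Laurent.coef g i.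
Proof. exact: monalg.mcoeffD. Qed.

Lemma laurent_coef0 i : Laurent.coef (0 : laurent A) i = 0.
Proof.
by apply: (addIr (Laurent.coef (0 : laurent A) i)); rewrite -laurent_coefD !add0r.
Qed.

Lemma laurent_coefN f i : Laurent.coef (- f) i = - Laurent.coef f i.
Proof. exact: monalg.mcoeffN. Qed.

Lemma laurent_coef_sum (I : Type) (r : seq I) (Q : pred I) (f : I -> laurent A) i :
  Laurent.coef (\sum_(j <- r | Q j) f j) i
  = \sum_(j <- r | Q j) Laurent.coef (f j) i.
Proof.
exact: (big_morph (fun f => Laurent.coef f i)
  (fun f g => laurent_coefD f g i) (laurent_coef0 i)).
Qed.

Lemma laurent_coefMz f c i : Laurent.coef (f *~ c) i = Laurent.coef f i *~ c.
Proof.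
have coefMn m : Laurent.coef (f *+ m) i = Laurent.coef f i *+ m.
  elim: m => [|m IHm]; first by rewrite !mulr0n laurent_coef0.
  by rewrite !mulrS laurent_coefD IHm.
by case: c => m; rewrite ?NegzE ?mulrNz ?laurent_coefN -!pmulrn coefMn.
Qed.

Lemma laurent_coef_monomial c j i :
  Laurent.coef (monomial c j : laurent A) i = c *+ (j == i).
Proof. exact: monalg.mcoeffU. Qed.

Lemma tpowD a b : tpow A (a + b) = tpow A a * tpow A b.
Proof. by rewrite /tpow mulrDr [RHS]Laurent.mulMM mulr1. Qed.

Lemma tpow0 : tpow A 0 = 1.
Proof. by rewrite /tpow mulr0. Qed.

Lemma tpowX a j : tpow A a ^+ j = tpow A (a * j%:Z).
Proof.
elim: j => [|j IHj]; first by rewrite expr0 mulr0 tpow0.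
by rewrite exprS IHj -tpowD intS mulrDr mulr1.
Qed.

Lemma coef_tpow_eval a e p i :
  Laurent.coef (tpow A a * eval_at p (tpow A e)) i
  = \sum_(j < size p | 2 * (a + e * j%:Z) == i) (p`_j)%:~R.
Proof.
have -> : tpow A a * eval_at p (tpow A e)
    = \sum_(j < size p) tpow A (a + e * j%:Z) *~ p`_j.
  rewrite /eval_at (@horner_coef_wide _ (size p)) ?size_poly //.
  rewrite mulr_sumr; apply: eq_bigr => j _.
  by rewrite coef_map /= tpowX mulrzl mulrzAr tpowD.
rewrite laurent_coef_sum [RHS]big_mkcond; apply: eq_bigr => j _.
by rewrite laurent_coefMz laurent_coef_monomial; case: ifP => _; rewrite ?mul0rz.
Qed.

Lemma coef_eval_even p (j : nat) :
  Laurent.coef (eval_at p (tpow A 1)) (2 * j%:Z) = (p`_j)%:~R.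
Proof.
have := coef_tpow_eval 0 1 p (2 * j%:Z); rewrite tpow0 mul1r => ->.
have [jp|jp] := ltnP j (size p); last first.
  rewrite nth_default // mulr0z big_pred0 // => i.
  by apply/negbTE; have := ltn_ord i; lia.
by rewrite (big_pred1 (Ordinal jp)) // => i; rewrite /= -val_eqE /=; lia.
Qed.

Lemma coef_eval_other p i :
  (forall j : nat, 2 * j%:Z != i) -> Laurent.coef (eval_at p (tpow A 1)) i = 0.
Proof.
move=> iN; have := coef_tpow_eval 0 1 p i; rewrite tpow0 mul1r => ->.
by rewrite big_pred0 // => j; rewrite add0r mul1r; apply/negbTE.
Qed.

End LaurentPolynomials.

Section Evaluation.
Variables (A : comNzRingType) (x : A).
Implicit Types p q : {poly int}.

Lemma eval_atM p q : eval_at (p * q) x = eval_at p x * eval_at q x.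
Proof. by rewrite /eval_at rmorphM hornerM. Qed.

Lemma eval_atN p : eval_at (- p) x = - eval_at p x.
Proof. by rewrite /eval_at rmorphN hornerN. Qed.

Lemma eval_at_sum (I : Type) (r : seq I) (Q : pred I) (p : I -> {poly int}) :
  eval_at (\sum_(j <- r | Q j) p j) x = \sum_(j <- r | Q j) eval_at (p j) x.
Proof. by rewrite /eval_at rmorph_sum horner_sum. Qed.

End Evaluation.

(** * Truncation *)

Section Truncation.
Import Num.Theory.
Implicit Types (d : rat) (f g : laurent rat).

Lemma coef_tau d g i :
  Laurent.coef (tau d g) i = if i%:~R <= d then Laurent.coef g i else 0.
Proof.
rewrite /tau laurent_coef_sum.
under eq_bigr do rewrite laurent_coef_monomial mulrb.
rewrite -big_mkcondr /=.
have [ig|ig] := boolP (i \in Laurent.supp g); last first.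
  rewrite big_seq_cond big_pred0 => [|j]; last first.
    by apply/and3P => -[jg _ /eqP ji]; rewrite ji (negbTE ig) in jg.
  by rewrite [Laurent.coef g i](monalg.mcoeff_outdom ig) if_same.
rewrite (big_rem i ig) /= eqxx andbT big_seq_cond big_pred0 ?addr0 // => j.
apply/and3P => -[jg _ /eqP ji]; move: jg.
by rewrite ji mem_rem_uniqF // finmap.fset_uniq.
Qed.

Lemma tauD d : {morph tau d : f g / f + g}.
Proof.
move=> f g; apply: laurentP => i; rewrite laurent_coefD !coef_tau laurent_coefD.
by case: ifP; rewrite ?addr0.
Qed.

Lemma tauN d : {morph tau d : f / - f}.
Proof.
move=> f; apply: laurentP => i; rewrite laurent_coefN !coef_tau laurent_coefN.
by case: ifP; rewrite ?oppr0.
Qed.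

Lemma tau0 d : tau d 0 = 0.
Proof. by apply: (addIr (tau d 0)); rewrite -tauD !add0r. Qed.

Lemma tau_sum d (I : Type) (r : seq I) (Q : pred I) (f : I -> laurent rat) :
  tau d (\sum_(j <- r | Q j) f j) = \sum_(j <- r | Q j) tau d (f j).
Proof. exact: (big_morph _ (tauD d) (tau0 d)). Qed.

Lemma tau_sign d (r : nat) f : tau d ((-1) ^+ r * f) = (-1) ^+ r * tau d f.
Proof.
elim: r => [|r IHr]; first by rewrite !expr0 !mul1r.
by rewrite !exprS !mulN1r !mulNr tauN IHr.
Qed.

(** In powers of t^(1/2), the coefficient p`_j sits at the exponent 2j. A bound d
    in [m - 1, m] keeps the exponents < m and drops those > m; the exponent m may
    be either kept or dropped, as p and q have no coefficient there. *)
Lemma tau_eval (m : nat) d (p q : {poly int}) :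
    m%:R - 1 <= d <= m%:R ->
    (forall j : nat, (m <= 2 * j)%N -> p`_j = 0) ->
    (forall j : nat, (2 * j <= m)%N -> p`_j = q`_j) ->
  eval_at p (tpow rat 1) = tau d (eval_at q (tpow rat 1)).
Proof.
move=> /andP[md dm] p0 pq; apply: laurentP => i; rewrite coef_tau.
have [/existsP[j /eqP <-]|iN] :=
    boolP [exists j : 'I_(`|i|).+1, 2 * (j : nat)%:Z == i]; last first.
  have iN' (j : nat) : 2 * j%:Z != i.
    apply: contra iN => /eqP ji; apply/existsP.
    have ji' : (j < `|i|.+1)%N by lia.
    by exists (Ordinal ji'); rewrite /= ji.
  by rewrite !coef_eval_other // if_same.
rewrite !coef_eval_even; case: ifPn => [le_jd|].
  rewrite pq // -(ler_nat rat); apply: Order.POrderTheory.le_trans dm.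
  by rewrite pmulrn PoszM.
rewrite -Order.TotalTheory.ltNge => lt_dj; rewrite p0 //.
have : m%:R - 1 < (2 * j)%:R :> rat.
  by rewrite (pmulrn 1 (2 * j)) PoszM (Order.POrderTheory.le_lt_trans md).
by rewrite ltrBlDr natr1 ltr_nat.
Qed.

End Truncation.

(** * Bruhat order and length *)

Section Bruhat.
Variables (W : finGroupType) (S : {set W}).
Implicit Types v w y : W.

Lemma bruhat_len v w : bruhat S v w -> (v == w) || (len S v < len S w)%N.
Proof.
case/connectP => c cP ->; elim: c v cP => [|y c IHc] v /=; first by rewrite eqxx.
case/andP=> /andP[_ vy] /IHc /orP[/eqP<-|yw]; rewrite ?vy ?orbT //.
by rewrite (ltn_trans vy yw) orbT.
Qed.

Lemma bruhat_lt_len v w : bruhat_lt S v w -> (len S v < len S w)%N.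
Proof. by case/andP=> /negbTE vw /bruhat_len; rewrite vw. Qed.

Lemma bruhat_lt_trans : transitive (bruhat_lt S).
Proof.
move=> y v w vy yw; apply/andP; split.
  apply/eqP=> e; move: (bruhat_lt_len vy) (bruhat_lt_len yw).
  by rewrite e => h1 h2; have := ltn_trans h1 h2; rewrite ltnn.
by case/andP: vy => _ vy; case/andP: yw => _ yw; apply: connect_trans vy yw.
Qed.

(** This makes the bound r <= #|W| in [chain_sum] harmless. *)
Lemma len_max w : (len S w <= #|W|)%N.
Proof. by rewrite /len (leq_trans (find_size _ _)) ?size_iota. Qed.

Lemma chain_lt v w c : is_chain S v w c -> bruhat_lt S v w.
Proof.
case: c => [//|v1 c] /= /andP[/eqP->].
move=> /(order_path_min bruhat_lt_trans) /allP; apply.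
by rewrite mem_rcons mem_head.
Qed.

End Bruhat.

(** * The recursion for Kazhdan-Lusztig polynomials *)

Section KLRecursion.
Variables (W : finGroupType) (S : {set W}) (R P : W -> W -> {poly int}).
Hypothesis klP : is_KL_family S R P.
Implicit Types v w y : W.

(** The defining identity of the Kazhdan-Lusztig family, read in Z[t]: its
    left-hand side is P_{v,w} with the order of its coefficients reversed. *)
Lemma coef_KL_sum v w (j : nat) : bruhat S v w ->
  (\sum_(y | bruhat S v y && bruhat S y w) R v y * P y w)`_j
  = if (j <= len S w - len S v)%N then (P v w)`_(len S w - len S v - j) else 0.
Proof.
case: klP => _ _ klE vw.
have le_vw : (len S v <= len S w)%N.
  by case/orP: (bruhat_len vw) => [/eqP->|/ltnW].
set q := \sum_(y | _) _; set m := (_ - _)%N.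
have -> : q`_j = Laurent.coef (eval_at q (tpow int 1)) (2 * j%:Z).
  by rewrite coef_eval_even intz.
have -> : eval_at q (tpow int 1)
    = tpow int m%:Z * eval_at (P v w) (tpow int (- 1)).
  rewrite /m -subzn // (klE _ _ vw) eval_at_sum.
  by apply: eq_bigr => y _; rewrite eval_atM.
rewrite coef_tpow_eval; case: ifPn => jm; last first.
  by rewrite big_pred0 // => i; lia.
have [ip|ip] := ltnP (m - j) (size (P v w)); last first.
  rewrite nth_default // big_pred0 // => i.
  by apply/negbTE; have := ltn_ord i; lia.
rewrite (big_pred1 (Ordinal ip)) ?intz // => i.
by rewrite /= -val_eqE /=; lia.
Qed.

(** This is the defining identity for v = w, where P_{w,w} = 1 and the sum is
    reduced to y = w. *)
Lemma R_diag w : R w w = 1.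
Proof.
case: (klP) => P1 _ _.
have only_w y : bruhat S w y && bruhat S y w = (y == w).
  apply/andP/eqP => [[/bruhat_len + /bruhat_len]|->]; last first.
    by rewrite /bruhat connect0.
  case/orP=> [/eqP //|wy] /orP[/eqP //|yw].
  by have := ltn_trans wy yw; rewrite ltnn.
apply/polyP=> j; have := @coef_KL_sum w w j (connect0 _ _).
rewrite (big_pred1 w) // P1 mulr1 subnn leqn0 sub0n => ->.
by rewrite !coef1; case: eqP.
Qed.

Lemma KL_coef_large v w (j : nat) : bruhat_lt S v w ->
  (len S w - len S v <= 2 * j)%N -> (P v w)`_j = 0.
Proof.
case: (klP) => _ degP _ vw le_j; apply: nth_default.
move: (degP _ _ vw) (bruhat_lt_len vw) le_j.
by move: (len S w) (len S v) (size _) => a b c; lia.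
Qed.

(** Up to the middle degree the reversal of P_{v,w} has no coefficient, so there
    the terms y = v and y = w of the identity, namely P_{v,w} and R_{v,w}, cancel
    against the other ones. *)
Lemma KL_coef_small v w (j : nat) : bruhat_lt S v w ->
    (2 * j <= len S w - len S v)%N ->
  (P v w)`_j
  = (- (R v w + \sum_(y | bruhat_lt S v y && bruhat_lt S y w) R v y * P y w))`_j.
Proof.
move=> vw le_j.
case/andP: (vw) => neq_vw le_vw; case: (klP) => P1 _ _.
have := @coef_KL_sum v w j le_vw.
have -> : (if (j <= len S w - len S v)%N
           then (P v w)`_(len S w - len S v - j) else 0) = 0.
  by case: ifP => // jm; apply: KL_coef_large => //; lia.
rewrite (bigD1 v) /=; last by rewrite [bruhat S v v]connect0.
rewrite (bigD1 w) /=; last by rewrite le_vw [bruhat S w w]connect0 eq_sym.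
rewrite R_diag P1 mul1r mulr1 coefD => /eqP; rewrite addr_eq0 => /eqP ->.
rewrite coefN; congr (- (polyseq (_ + _))`_j); apply: eq_bigl => y.
rewrite /bruhat_lt (eq_sym v y).
by case: (y == v); case: (y == w); rewrite /= ?andbF ?andbT.
Qed.

(** As P_{v,w} has no coefficient in the middle degree, truncating at
    l(w) - l(v) or at l(w) - l(v) - 1 gives the same result: the former bound is
    used inside the chain terms, the latter outside. *)
Lemma KL_tau v w (d : rat) : bruhat_lt S v w ->
    (len S w)%:R - (len S v)%:R - 1 <= d <= (len S w)%:R - (len S v)%:R ->
  eval_at (P v w) (tpow rat 1)
  = tau d (- (eval_at (R v w) (tpow rat 1)
      + \sum_(y | bruhat_lt S v y && bruhat_lt S y w)
          eval_at (R v y) (tpow rat 1) * eval_at (P y w) (tpow rat 1))).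
Proof.
move=> vw; rewrite -natrB ?(ltnW (bruhat_lt_len vw)) // => dP.
rewrite (tau_eval dP (fun j => @KL_coef_large v w j vw)
                     (fun j => @KL_coef_small v w j vw)).
rewrite eval_atN {1}/eval_at rmorphD hornerD -!/(eval_at _ _) eval_at_sum.
by under eq_bigr do rewrite eval_atM.
Qed.

End KLRecursion.

(** * Sums over chains *)

Section Chains.
Variables (W : finGroupType) (S : {set W}) (R : W -> W -> {poly int}) (w : W).
Implicit Types v y : W.

Definition chain_sum_size (r : nat) v : laurent rat :=
  \sum_(c : r.-tuple W | is_chain S v w c) (-1) ^+ r * chain_term S R w c.

Lemma chain_sum_size1 v : bruhat_lt S v w ->
  chain_sum_size 1 v = - eval_at (R v w) (tpow rat 1).
Proof.
move=> vw; rewrite /chain_sum_size (big_pred1 [tuple v]) => [|c].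
  by rewrite expr1 mulN1r.
case/tupleP: c => y c; rewrite tuple0 /= -val_eqE /= andbT eqseq_cons eqxx andbT.
by case: eqP => // ->.
Qed.

(** A chain v < y < ... of length at least 2 is v followed by a chain from y. *)
Lemma chain_sum_sizeS r v :
  chain_sum_size r.+2 v
  = - \sum_(y | bruhat_lt S v y && bruhat_lt S y w)
        eval_at (R v y) (tpow rat 1)
        * tau ((len S w)%:R - (len S y)%:R) (chain_sum_size r.+1 y).
Proof.
rewrite {1}/chain_sum_size.
rewrite (reindex_onto (fun c : r.+1.-tuple W => [tuple of v :: c])
                      (fun c => [tuple of behead c])) /=; last first.
  case/tupleP => v1 c /= /andP[/eqP-> _]; exact: val_inj.
rewrite (partition_big (fun c : r.+1.-tuple W => thead c)
           (fun y => bruhat_lt S v y && bruhat_lt S y w)) /=; last first.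
  case/tupleP => y c; rewrite theadE /= eqxx /= => /andP[/andP[-> pc] _] /=.
  by apply: (@chain_lt _ _ _ _ (y :: c)); rewrite /= eqxx.
rewrite -sumrN; apply: eq_bigr => y /andP[vy _].
rewrite tau_sum mulr_sumr -sumrN; apply: eq_big => [c|].
  case/tupleP: c => y1 c; rewrite theadE /= eqxx /=.
  have -> : [tuple of behead (v :: y1 :: c)] == [tuple of y1 :: c].
    by rewrite -val_eqE.
  by rewrite andbT andbC; case: eqP => //= ->; rewrite vy.
case/tupleP => y1 c; rewrite theadE => /andP[_ /eqP->].
by rewrite tau_sign [in LHS]exprS mulN1r mulNr mulrCA.
Qed.

(** Induction on m, the recursions of [KL_tau] and [chain_sum_sizeS] being the
    same. The bound l(w) - l(v) <= m makes the partial sum complete, and it is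
    inherited by every y > v with m - 1 in place of m. *)
Lemma tau_partial_chain_sum (P : W -> W -> {poly int}) (m : nat) v (d : rat) :
    is_KL_family S R P -> bruhat_lt S v w -> (len S w - len S v <= m)%N ->
    (len S w)%:R - (len S v)%:R - 1 <= d <= (len S w)%:R - (len S v)%:R ->
  tau d (\sum_(1 <= r < m.+1) chain_sum_size r v) = eval_at (P v w) (tpow rat 1).
Proof.
move=> klP; elim: m v d => [|m IHm] v d vw lm dP.
  by have := bruhat_lt_len vw; lia.
rewrite (KL_tau klP vw dP) big_ltn // chain_sum_size1 // opprD.
congr (tau d (_ + _)).
rewrite big_add1 /= big_add1 /=.
under eq_bigr do rewrite chain_sum_sizeS.
rewrite sumrN exchange_big /=; congr (- _); apply: eq_bigr => y /andP[vy yw].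
rewrite -mulr_sumr -tau_sum; congr (_ * _).
rewrite -(IHm y ((len S w)%:R - (len S y)%:R)) ?big_add1 //.
  by have := bruhat_lt_len vy; lia.
by rewrite Order.POrderTheory.lexx Num.Theory.gerBl Num.Theory.ler01.
Qed.

End Chains.

Unset Implicit Arguments.
Set Strict Implicit.

Theorem mainTheorem1
  (F : finFieldType) (k : closedFieldType) (iota : {rmorphism F -> k})
  (n : nat) (G B T : 'M[k]_n -> Prop)
  (hG : split_reductive iota G B T)
  (W : finGroupType) (pi : 'M[k]_n -> W)
  (hW : is_quotient (normalizer G T) T pi)
  (S : {set W}) (hS : S = simple_reflections G T B pi)
  (H : algType (laurent int)) (Tw : W -> H)
  (hH : is_hecke_algebra S Tw)
  (R : W -> W -> {poly int}) (hR : is_R_family S Tw R)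
  (P : W -> W -> {poly int}) (hP : is_KL_family S R P)
  (v w : W) (hvw : bruhat_lt S v w) :
  eval_at (P v w) (tpow rat 1)
  = tau ((len S w)%:R - (len S v)%:R - 1) (chain_sum S R v w).
Proof.
rewrite -[chain_sum S R v w]/(\sum_(1 <= r < #|W|.+1) chain_sum_size S R w r v).
rewrite (tau_partial_chain_sum hP hvw) //.
  by rewrite (leq_trans (leq_subr _ _)) ?len_max.
by rewrite Order.POrderTheory.lexx Num.Theory.gerBl Num.Theory.ler01.
Qed.
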